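(* Let $A$ be the convolution matrix of $\mathbb{F}_2^n$, let $M_H$ be the adjacency matrix of the subspace hypergraph $\mathcal{H}_n$, let $f:\mathbb{F}_2^n\to\mathbb{C}$, and let $f'$ be the restriction of $f$ to $\mathbb{F}_2^n\setminus\{\overline 0\}$. (i) If $f$ is an eigenvector of $A$ corresponding to an eigenvalue $\theta$ and $f(\overline 0)=0$, then $f'$ is an eigenvector of $M_H$ with eigenvalue $\theta/2$. (ii) If $f$ is an eigenvector of $A$ corresponding to an eigenvalue $\theta$ and $f:\mathbb{F}_2^n\to\{0,1\}$, then $f'$ is an eigenvector of $M_H$ with eigenvalue $\theta/2-f(\overline 0)$.
   Context: $\overline 0$ is the zero vector of $\mathbb{F}_2^n$. The convolution matrix $A=(a_{x,y,z})$ of $\mathbb{F}_2^n$ is the $3$-dimensional matrix indexed by $x,y,z\in\mathbb{F}_2^n$, with $a_{x,y,z}=1$ if $x=y+z$ and $0$ otherwise. The subspace hypergraph $\mathcal{H}_n$ is the $3$-uniform hypergraph with vertex set $\mathbb{F}_2^n\setminus\{\overline 0\}$ whose hyperedges are the $3$-element sets $\{x,y,z\}$ of vertices with $x+y+z=\overline 0$. Its adjacency matrix $M_H=(m_{x,y,z})$ is indexed by triples of vertices, with $m_{x,y,z}=\frac12$ if $\{x,y,z\}$ is a hyperedge and $0$ otherwise. For a $3$-dimensional matrix $B=(b_{x,y,z})$ indexed by a finite set $X$, a number $\theta\in\mathbb{C}$ is an eigenvalue with eigenvector $h:X\to\mathbb{C}$, $h\not\equiv 0$, if $\sum_{y,z\in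 X}b_{x,y,z}h(y)h(z)=\theta h(x)^2$ for all $x\in X$.
   Formalization: In (ii), f is additionally assumed not to be the indicator function of the zero vector: that f is a {0,1}-valued eigenvector of A with θ = 1, but its restriction f' is identically zero and hence not an eigenvector. *)

(* Defs.v *)
From HB Require Import structures.
From mathcomp Require Import all_boot all_order all_algebra.
From mathcomp Require Import reals complex.

Set Implicit Arguments.
Unset Strict Implicit.
Unset Printing Implicit Defensive.

Import GRing.Theory.
Local Open Scope ring_scope.

Definition matrix3 (X : finType) (C : Type) := X -> X -> X -> C.

Definition eigenvector (X : finType) (C : fieldType) (B : matrix3 X C)
    (theta : C) (h : X -> C) : Prop :=
  (exists x, h x != 0) /\
  forall x, \sum_(y : X) \sum_(z : X) B x y z * h y * h z = theta * h x ^+ 2.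

Definition convolution_matrix (C : fieldType) (n : nat) :
    matrix3 'rV['F_2]_n C :=
  fun x y z => if x == y + z then 1 else 0.

Definition nonzero_vector (n : nat) := {x : 'rV['F_2]_n | x != 0}.

(* The cardinality condition says that x, y and z are pairwise distinct. *)
Definition subspace_hypergraph (n : nat) : {set {set nonzero_vector n}} :=
  [set e : {set nonzero_vector n} | (#|e| == 3) &&
    [exists x, exists y, exists z,
       (e == [set x; y; z]) && (val x + val y + val z == 0)]].

(* For the edge set E of a 3-uniform hypergraph, the entry vanishes whenever
   two of the indices coincide. *)
Definition adjacency_matrix (C : fieldType) (V : finType) (E : {set {set V}}) :
    matrix3 V C :=
  fun x y z => if [set x; y; z] \in E then 2^-1 else 0.

Definition restriction (C : Type) (n : nat) (f : 'rV['F_2]_n -> C) :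
    nonzero_vector n -> C :=
  fun x => f (val x).

(* Main.v *)
Require Import Defs.
From mathcomp Require Import all_boot all_order all_algebra.
From mathcomp Require Import reals complex.
Import GRing.Theory.
Local Open Scope ring_scope.

(** Fix a nonzero vector [x].  In the sum of [f y * f z] over all pairs with
    [x = y + z], the pairs in which [y] or [z] vanishes are exactly [(0, x)] and
    [(x, 0)], and they contribute [2 * f 0 * f x].  In every other pair
    [x, y, z] are nonzero with sum zero, hence pairwise distinct (two equal
    vectors cancel in characteristic 2, which would make the third one zero), so
    they form a hyperedge; there the convolution matrix has entry 1 and the
    adjacency matrix has entry 1/2 ([subspace_hypergraphE]).  Hence
    [(A f f)(x) = 2 * f 0 * f x + 2 * (M f' f')(x)] ([convolution_adjacency]),
    and an eigenvector [f] of the convolution matrix satisfies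
    [(M f' f')(x) = theta / 2 * f x ^ 2 - f 0 * f x].

    The last term vanishes if [f 0 = 0]; and if [f] takes only the values 0 and
    1, then [f x = f x ^ 2] merges it with the first one.  It remains that
    [f'] is not identically zero: this is clear if [f 0 = 0], and a 0/1-valued
    eigenvector supported at the origin is the indicator function of the origin,
    whose restriction is zero and which the hypotheses therefore exclude. *)

Lemma cards3 (T : finType) (x y z : T) :
  (#|[set x; y; z]| == 3%N) = [&& x != y, x != z & y != z].
Proof.
rewrite setUC cardsU1 cards2 !inE (eq_sym z x) (eq_sym z y) negb_or.
by case: (x != y); case: (x != z); case: (y != z).
Qed.

Lemma big_set3 (T : finType) (V : nmodType) (F : T -> V) (x y z : T) :
  #|[set x; y; z]| == 3%N ->
  \sum_(u in [set x; y; z]) F u = F x + F y + F z.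
Proof.
rewrite cards3 => /and3P[xy xz yz].
rewrite setUC big_setU1; last by rewrite !inE negb_or !(eq_sym z) xz.
by rewrite big_setU1 ?inE // big_set1 addrC.
Qed.

Lemma addvv_F2 (n : nat) (v : 'rV['F_2]_n) : v + v = 0.
Proof. by apply/rowP => i; rewrite !mxE addrr_pchar2 // pchar_Fp. Qed.

Lemma addv_eq0_F2 (n : nat) (u v : 'rV['F_2]_n) : (u + v == 0) = (u == v).
Proof. by rewrite -[X in _ + X]opprK subr_eq0 -[- v]addr0 -(addvv_F2 n v) addKr. Qed.

(** A hyperedge is presented by some triple with sum zero, not necessarily the
    given one; comparing the sums of all elements of the two equal sets
    transfers the relation to [x, y, z].  Conversely, distinctness is automatic
    for nonzero vectors, since equality of two of them would annihilate the
    third. *)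
Lemma subspace_hypergraphE (n : nat) (x y z : nonzero_vector n) :
  ([set x; y; z] \in subspace_hypergraph n) = (val x == val y + val z).
Proof.
rewrite inE -addv_eq0_F2 addrA; apply/andP/idP => [[card3]|sum0].
  move=> /existsP[a /existsP[b /existsP[c /andP[/eqP eq_abc]]]].
  rewrite -(@big_set3 _ _ val) -?eq_abc //.
  by rewrite (@big_set3 _ _ val).
split; last first.
  by apply/existsP; exists x; apply/existsP; exists y; apply/existsP; exists z;
    rewrite eqxx.
rewrite cards3; apply/and3P; split.
- apply: contraTneq sum0 => ->; rewrite addvv_F2 add0r; exact: valP z.
- apply: contraTneq sum0 => ->; rewrite addrAC addvv_F2 add0r; exact: valP y.
- apply: contraTneq sum0 => ->; rewrite -addrA addvv_F2 addr0; exact: valP x.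
Qed.

Lemma adjacency_subspaceE (C : fieldType) (n : nat) (x y z : nonzero_vector n) :
  adjacency_matrix C (subspace_hypergraph n) x y z =
  2^-1 * convolution_matrix C (val x) (val y) (val z).
Proof.
rewrite /adjacency_matrix /convolution_matrix subspace_hypergraphE.
by case: ifP; rewrite ?mulr1 ?mulr0.
Qed.

Lemma sum_pred1 (C : pzSemiRingType) (T : finType) (i : T) (F : T -> C) :
  \sum_j (if i == j then 1 else 0) * F j = F i.
Proof.
rewrite (bigD1 i) //= eqxx mul1r big1 ?addr0 // => j.
by rewrite eq_sym => /negPf->; rewrite mul0r.
Qed.

(** Away from the origin, the convolution and adjacency forms differ by the
    factor 2 and by the two degenerate pairs [(0, x)] and [(x, 0)]. *)
Lemma convolution_adjacency (C : fieldType) (n : nat)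
    (f : 'rV['F_2]_n -> C) (x : nonzero_vector n) :
  2 != 0 :> C ->
  \sum_y \sum_z convolution_matrix C (val x) y z * f y * f z =
  2 * (f 0 * f (val x)) +
  2 * \sum_y \sum_z adjacency_matrix C (subspace_hypergraph n) x y z
        * restriction f y * restriction f z.
Proof.
move=> two_neq0; rewrite (bigD1 0) //=.
have -> : \sum_z convolution_matrix C (val x) 0 z * f 0 * f z
    = f 0 * f (val x).
  rewrite -[RHS](sum_pred1 _ _ (val x) (fun z => f 0 * f z)).
  by apply: eq_bigr => z _; rewrite /convolution_matrix add0r mulrA.
under eq_bigr => y _ do rewrite (bigD1 0) //=.
rewrite big_split /=.
have -> : \sum_(y | y != 0) convolution_matrix C (val x) y 0 * f y * f 0
    = f 0 * f (val x).
  rewrite (bigD1 (val x)) ?(valP x) //= big1 => [|y /andP[_ yx]].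
    by rewrite addr0 /convolution_matrix addr0 eqxx mul1r mulrC.
  by rewrite /convolution_matrix addr0 eq_sym (negPf yx) !mul0r.
rewrite addrA -mulr2n mulr_natl; congr (_ + _).
rewrite big_distrr /= (big_sub (fun y => y != 0)); apply: eq_bigr => y _.
rewrite big_distrr /= (big_sub (fun z => z != 0)); apply: eq_bigr => z _.
by rewrite adjacency_subspaceE !mulrA mulfV // mul1r.
Qed.

Lemma adjacency_eigen_equation (C : fieldType) (n : nat)
    (f : 'rV['F_2]_n -> C) (theta : C) (x : nonzero_vector n) :
  2 != 0 :> C -> eigenvector (@convolution_matrix C n) theta f ->
  \sum_y \sum_z adjacency_matrix C (subspace_hypergraph n) x y z
    * restriction f y * restriction f z =
  theta / 2 * f (val x) ^+ 2 - f 0 * f (val x).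
Proof.
move=> two_neq0 [_ /(_ (val x))]; rewrite convolution_adjacency // => eqx.
apply: (mulfI two_neq0); rewrite mulrBr mulrA (mulrC 2 (theta / 2)) divfK // -eqx.
by rewrite addrC addKr.
Qed.

Theorem corollary2 (R : realType) (n : nat) (f : 'rV['F_2]_n -> R[i])
    (theta : R[i]) :
  (eigenvector (@convolution_matrix R[i] n) theta f ->
   f 0 = 0 ->
   eigenvector (adjacency_matrix R[i] (subspace_hypergraph n))
     (theta / 2) (restriction f)) /\
  (eigenvector (@convolution_matrix R[i] n) theta f ->
   (forall x, f x = 0 \/ f x = 1) ->
   ~ (f =1 (fun x => if x == 0 then 1 else 0)) ->
   eigenvector (adjacency_matrix R[i] (subspace_hypergraph n))
     (theta / 2 - f 0) (restriction f)).
Proof.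
have two_neq0 : 2 != 0 :> R[i] by rewrite Num.Theory.pnatr_eq0.
split=> [eig f0|eig f01 f_delta].
  split; last by move=> x; rewrite (adjacency_eigen_equation _ _ _ theta) // f0 mul0r subr0.
  have [[x fx] _] := eig.
  have x_neq0 : x != 0 by apply: contraNneq fx => ->; rewrite f0.
  by exists (exist _ x x_neq0).
split; last first.
  move=> x; rewrite (adjacency_eigen_equation _ _ _ theta) // mulrBl /restriction.
  by case: (f01 (val x)) => ->; rewrite ?expr0n ?expr1n ?mulr0.
have [/existsP //|/existsPn f'0] :=
  boolP [exists x : nonzero_vector n, restriction f x != 0].
have f_off0 y : y != 0 -> f y = 0.
  by move=> y_neq0; apply/eqP; rewrite -[_ == _]negbK (f'0 (exist _ y y_neq0)).
have [[x fx] _] := eig; case: f_delta => y.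
have [->|/f_off0 //] := eqVneq y 0.
have x0 : x = 0 by apply/eqP; apply: contraNT fx => /f_off0 ->.
by move: fx; rewrite x0; case: (f01 0) => ->; rewrite ?eqxx.
Qed.
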